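(* Let $0<q<p$ be real numbers and let $f\in\mathfrak{A}(p,q)$. Then $f$ has an inverse with respect to $*$, i.e. there is a set $g\in\mathfrak{A}(p,q)$ such that $$f*g=g*f=I,$$ where $I=\{p^{\binom n2}x^n\}_{n\ge 0}$.
   Context: Polynomials have complex coefficients. Notation: $[n]_{p,q}=\frac{p^n-q^n}{p-q}$; $\binom{n}{2}=\frac{n(n-1)}{2}$; $D_{p,q}f(x)=\frac{f(px)-f(qx)}{(p-q)x}$ for $x\neq 0$, $(D_{p,q}f)(0)=f'(0)$. A polynomial set is a sequence $f=\{f_n(x)\}_{n\ge 0}$ with $f_n(x)$ of exact degree $n$. $\mathfrak{A}(p,q)$ is the class of all $(p,q)$-Appell sets, i.e. polynomial sets with $D_{p,q}f_{n+1}(x)=[n+1]_{p,q}f_n(px)$ for all $n\ge 0$. For polynomial sets $f,g$ with $f_n(x)=\sum_{k=0}^n\alpha(n,k)x^k$, the product $f*g$ is the polynomial set with $n$-th component $(f*g)_n(x)=\sum_{k=0}^n\alpha(n,k)\,p^{-\binom k2}g_k(x)$. The set $I$ is the identity element of $\mathfrak{A}(p,q)$ for $*$. *)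

(* Defs.v *)
From HB Require Import structures.
From mathcomp Require Import all_boot all_order all_algebra.
From mathcomp Require Import reals complex.

Set Implicit Arguments.
Unset Strict Implicit.
Unset Printing Implicit Defensive.

Import Order.TTheory GRing.Theory Num.Theory.
Local Open Scope ring_scope.
Local Open Scope complex_scope.

Definition pq_number (R : realType) (p q : R) (n : nat) : R :=
  (p ^+ n - q ^+ n) / (p - q).

(* Defined on polynomial functions only, so the value at 0 can use the formal
   derivative. *)
Definition pq_deriv (R : realType) (p q : R) (f : {poly R[i]}) (x : R[i]) : R[i] :=
  if x == 0 then f^`().[0]
  else (f.[p%:C * x] - f.[q%:C * x]) / ((p%:C - q%:C) * x).

Definition polynomial_set (R : realType) (f : nat -> {poly R[i]}) : Prop :=
  forall n : nat, size (f n) = n.+1.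

Definition pq_Appell (R : realType) (p q : R) (f : nat -> {poly R[i]}) : Prop :=
  polynomial_set f /\
  forall (n : nat) (x : R[i]),
    pq_deriv p q (f n.+1) x = (pq_number p q n.+1)%:C * (f n).[p%:C * x].

Definition set_mul (R : realType) (p : R) (f g : nat -> {poly R[i]}) :
    nat -> {poly R[i]} :=
  fun n => \sum_(k < n.+1) ((f n)`_k * p%:C ^- 'C(k, 2)) *: g k.

Definition set_one (R : realType) (p : R) : nat -> {poly R[i]} :=
  fun n => p%:C ^+ 'C(n, 2) *: 'X^n.

(* Main.v *)
Require Import Defs.
From HB Require Import structures.
From mathcomp Require Import all_boot all_order all_algebra.
From mathcomp Require Import reals complex ring.

Set Implicit Arguments.
Unset Strict Implicit.
Unset Printing Implicit Defensive.

Import Order.TTheory GRing.Theory Num.Theory.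
Local Open Scope ring_scope.
Local Open Scope complex_scope.

(** Comparing coefficients, [f] is (p,q)-Appell iff
    [f_n = \sum_k [n]!/[k]! a_(n-k) p^(k choose 2) x^k] for some sequence [a]
    with [a_0 <> 0], where [[n]!] is the (p,q)-factorial. Under [f <-> a] the
    product [*] becomes the Cauchy product of sequences and [I] becomes
    [(1, 0, 0, ...)], so an inverse of [f] is the reciprocal of the formal power
    series [\sum_n a_n t^n]; commutativity makes it two-sided. *)

Definition cauchy_prod (A : pzSemiRingType) (a b : nat -> A) (n : nat) : A :=
  \sum_(i < n.+1) a i * b (n - i)%N.

Lemma cauchy_prodC (A : comPzSemiRingType) (a b : nat -> A) :
  cauchy_prod a b =1 cauchy_prod b a.
Proof.
move=> n; rewrite /cauchy_prod (reindex_inj rev_ord_inj) /=.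
by apply: eq_bigr => i _; rewrite subSS subKn 1?mulrC // -ltnS.
Qed.

Section Reciprocal.
Variables (F : fieldType) (a : nat -> F).

(** Each coefficient of the reciprocal depends on all earlier ones, so the recursion carries the
    whole list of them to stay structural. *)
Fixpoint reciprocal_prefix (n : nat) : seq F :=
  if n is m.+1 then
    let s := reciprocal_prefix m in
    rcons s (((m == 0)%:R - \sum_(i < m) s`_i * a (m - i)) / a 0)
  else [::].

Definition reciprocal (n : nat) : F := (reciprocal_prefix n.+1)`_n.

Lemma size_reciprocal_prefix n : size (reciprocal_prefix n) = n.
Proof. by elim: n => //= n IHn; rewrite size_rcons IHn. Qed.

Lemma nth_reciprocal_prefix n i :
  (i < n)%N -> (reciprocal_prefix n)`_i = reciprocal i.
Proof.
elim: n => // n IHn; rewrite ltnS leq_eqVlt => /predU1P[-> //|lt_in].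
by rewrite /= nth_rcons size_reciprocal_prefix lt_in IHn.
Qed.

Lemma reciprocal_prod :
  a 0 != 0 -> cauchy_prod reciprocal a =1 (fun n => (n == 0)%:R).
Proof.
move=> a0 n; rewrite /cauchy_prod big_ord_recr /= subnn.
rewrite {2}/reciprocal /= nth_rcons size_reciprocal_prefix ltnn eqxx divfK //.
under [in X in _ + (_ - X)]eq_bigr => i _ do rewrite nth_reciprocal_prefix //.
by rewrite addrC subrK.
Qed.

End Reciprocal.

(** Characteristic zero makes the integers [0, 1, 2, ...] distinct in [K], so a nonzero [f - g]
    would have more roots than its degree allows. *)
Lemma horner_inj (K : numDomainType) (f g : {poly K}) :
  (forall x, f.[x] = g.[x]) -> f = g.
Proof.
move=> fg; apply/eqP; rewrite -subr_eq0; apply/negPn/negP => h0.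
pose s : seq K := [seq i%:R | i <- iota 0 (size (f - g))].
have us : uniq s by rewrite map_inj_uniq ?iota_uniq //; apply: mulrIn; rewrite oner_eq0.
have rs : all (root (f - g)) s.
  by apply/allP => x _; rewrite rootE hornerD hornerN fg subrr.
by have := max_poly_roots h0 rs us; rewrite size_map size_iota ltnn.
Qed.

Section Appell.
Variables (R : realType) (p q : R).
Hypotheses (q_gt0 : 0 < q) (q_lt_p : q < p).

Local Notation "[ n ]" := ((pq_number p q n)%:C) (at level 0, format "[ n ]").

Definition pq_fact (n : nat) : R[i] := \prod_(i < n) [i.+1].

Definition Appell_of (a : nat -> R[i]) (n : nat) : {poly R[i]} :=
  \poly_(k < n.+1) (pq_fact n / pq_fact k * a (n - k)%N * p%:C ^+ 'C(k, 2)).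

Let p_gt0 : 0 < p. Proof. exact: lt_trans q_lt_p. Qed.

Let pq_neq0 : p%:C - q%:C != 0 :> R[i].
Proof. by rewrite -rmorphB fmorph_eq0 subr_eq0 gt_eqF. Qed.

Lemma pX_neq0 n : p%:C ^+ n != 0 :> R[i].
Proof. by rewrite expf_neq0 // fmorph_eq0 gt_eqF. Qed.

Lemma pq_numberS_neq0 n : [n.+1] != 0 :> R[i].
Proof.
rewrite fmorph_eq0 mulf_neq0 ?invr_eq0 ?subr_eq0 ?gt_eqF //.
by rewrite ltrXn2r // ?ltW.
Qed.

Lemma pq_factS n : pq_fact n.+1 = pq_fact n * [n.+1].
Proof. exact: big_ord_recr. Qed.

Lemma pq_fact_neq0 n : pq_fact n != 0.
Proof. by apply/prodf_neq0 => i _; apply: pq_numberS_neq0. Qed.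

Lemma pq_derivE (f : {poly R[i]}) x :
  pq_deriv p q f x = (\poly_(k < size f) ([k.+1] * f`_k.+1)).[x].
Proof.
rewrite /pq_deriv; have [->|x0] := eqVneq x 0.
  rewrite !horner_coef0 coef_deriv coef_poly mulr1n.
  rewrite /pq_number !expr1 divff ?subr_eq0 ?gt_eqF // rmorph1 mul1r.
  (* For [f = 0] the right-hand polynomial has no coefficients, and [f'(0)] is zero too. *)
  by case: (posnP (size f)) => // f0; rewrite nth_default // f0.
(* One extra zero coefficient leaves exactly [size f] terms once the constant terms cancel. *)
rewrite horner_poly !(@horner_coef_wide _ (size f).+1) //.
rewrite !big_ord_recl !expr0 opprD addrACA subrr add0r -sumrB mulr_suml.
apply: eq_bigr => i _; rewrite lift0.
rewrite /pq_number fmorph_div !rmorphB !rmorphXn /=.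
rewrite !exprMn -mulrBr -mulrBl [x ^+ i.+1]exprSr.
by field; rewrite x0 pq_neq0.
Qed.

Lemma pq_AppellP (f : nat -> {poly R[i]}) :
  pq_Appell p q f <->
  polynomial_set f /\
  forall n k, [k.+1] * (f n.+1)`_k.+1 = [n.+1] * (f n)`_k * p%:C ^+ k.
Proof.
have rhsE n x : [n.+1] * (f n).[p%:C * x] =
    (\poly_(k < size (f n)) ([n.+1] * (f n)`_k * p%:C ^+ k)).[x].
  rewrite horner_poly horner_coef mulr_sumr; apply: eq_bigr => i _.
  by rewrite exprMn !mulrA.
split=> -[fS fA]; split=> // n.
  have /polyP E := horner_inj (fun x =>
    etrans (esym (pq_derivE _ x)) (etrans (fA n x) (rhsE n x))).
  move=> k; have [le_kn|lt_nk] := leqP k n.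
    by have := E k; rewrite !coef_poly !fS !ltnS le_kn leqW.
  by rewrite !nth_default ?fS ?mulr0 ?mul0r.
move=> x; rewrite pq_derivE rhsE !horner_poly !fS big_ord_recr /=.
(* The term split off involves the coefficient of index [n.+2] of [f n.+1], which exceeds the
   degree. *)
rewrite nth_default ?fS // mulr0 mul0r addr0.
by apply: eq_bigr => k _; rewrite fA.
Qed.

Lemma coef_Appell_of a n k : (Appell_of a n)`_k =
  if (k <= n)%N then pq_fact n / pq_fact k * a (n - k)%N * p%:C ^+ 'C(k, 2) else 0.
Proof. by rewrite coef_poly ltnS. Qed.

Lemma eq_Appell_of a b : a =1 b -> Appell_of a =1 Appell_of b.
Proof. by move=> ab n; apply/polyP => k; rewrite !coef_Appell_of ab. Qed.

(** The factor [p^k] comes from [C(k+1, 2) = C(k, 2) + k]. A single [c] suffices because [a (n - k)]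
    is constant along the diagonal from [(n, k)] to [(n+1, k+1)]. *)
Lemma Appell_coefS n k (c : R[i]) :
  [k.+1] * (pq_fact n.+1 / pq_fact k.+1 * c * p%:C ^+ 'C(k.+1, 2)) =
  [n.+1] * (pq_fact n / pq_fact k * c * p%:C ^+ 'C(k, 2)) * p%:C ^+ k.
Proof.
rewrite !pq_factS binS bin1 exprD.
by field; rewrite pq_fact_neq0 pq_numberS_neq0.
Qed.

Lemma Appell_of_Appell a : a 0 != 0 -> pq_Appell p q (Appell_of a).
Proof.
move=> a0; apply/pq_AppellP; split=> n.
  by rewrite size_poly_eq // subnn !mulf_neq0 ?invr_eq0 ?pq_fact_neq0 ?pX_neq0.
move=> k; rewrite !coef_Appell_of ltnS subSS; case: leqP => _; last by rewrite !mulr0 mul0r.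
exact: Appell_coefS.
Qed.

(** The coefficient recurrence moves along diagonals, so coefficient [k] of [f n] is determined by
    the constant coefficient of [f (n - k)]; this dictates the choice of [a]. *)
Lemma Appell_sequence (f : nat -> {poly R[i]}) :
  pq_Appell p q f -> exists2 a, a 0 != 0 & f =1 Appell_of a.
Proof.
case/pq_AppellP => fS fA; exists (fun m => (f m)`_0 / pq_fact m).
  rewrite mulf_neq0 ?invr_eq0 ?pq_fact_neq0 //.
  (* As [f 0] has degree 0, its constant coefficient is its leading one. *)
  by have := lead_coef_eq0 (f 0); rewrite lead_coefE -size_poly_eq0 fS /= => ->.
move=> n; apply/polyP => k; rewrite coef_Appell_of.
case: leqP => [|lt_nk]; last by rewrite nth_default ?fS.
elim: k n => [|k IHk] n le_kn.
  rewrite subn0 expr0 mulr1 /pq_fact [X in _ / X]big_ord0 divr1 mulrCA divff ?mulr1 //.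
  exact: pq_fact_neq0.
case: n le_kn => // n le_kn.
apply: (mulfI (pq_numberS_neq0 k)); rewrite fA IHk // subSS.
by rewrite Appell_coefS.
Qed.

(** The weight [p^(-C(j, 2))] in the product cancels the power of [p] in the coefficients of
    [Appell_of a], and the factors [[j]!] cancel. What remains is the sum of [a (n - j) * b (j - k)]
    over [k <= j <= n]. *)
Lemma set_mul_Appell_of a b :
  set_mul p (Appell_of a) (Appell_of b) =1 Appell_of (cauchy_prod a b).
Proof.
move=> n; apply/polyP => k; rewrite /set_mul coef_sum coef_Appell_of.
under eq_bigr => j _ do
  rewrite coefZ !coef_Appell_of -ltnS ltn_ord mulfK ?pX_neq0 // (fun_if (GRing.mul _)) mulr0.
rewrite -big_mkcond /=; case: leqP => [le_kn|lt_nk]; last first.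
  rewrite big_pred0 // => j; apply/negbTE; rewrite -ltnNge.
  exact: leq_trans (ltn_ord j) lt_nk.
(* With [b] carrying the summation index, the two sums differ only by the shift of [j] by [k]. *)
rewrite cauchy_prodC /cauchy_prod mulr_sumr mulr_suml.
rewrite -(big_mkord (fun j => (k <= j)%N) (fun j => pq_fact n / pq_fact j * a (n - j)%N *
  (pq_fact j / pq_fact k * b (j - k)%N * p%:C ^+ 'C(k, 2)))).
rewrite -(big_mkord xpredT (fun j => pq_fact n / pq_fact k * (b j * a (n - k - j)%N) *
  p%:C ^+ 'C(k, 2))).
rewrite (big_cat_nat _ (n := k)) //=; last exact: leqW.
rewrite big_nat_cond big_pred0 ?add0r; last first.
  by move=> j; case: leqP; rewrite ?andbF.
rewrite -{1}[k]add0n big_addn subSn // !big_mkord; apply: eq_big => j.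
  by rewrite leq_addl.
move=> _; rewrite addnK subnDA subnAC.
by field; rewrite !pq_fact_neq0.
Qed.

Lemma Appell_of_one : Appell_of (fun n => (n == 0)%:R) =1 set_one p.
Proof.
move=> n; apply/polyP => k; rewrite coef_Appell_of coefZ coefXn subn_eq0.
case: ltngtP => [_|_|->]; rewrite ?mulr0 ?mul0r //.
by rewrite divff ?pq_fact_neq0 // !mulr1 mul1r.
Qed.

End Appell.

Theorem corollary10 (R : realType) (p q : R) (q_gt0 : 0 < q) (q_lt_p : q < p)
    (f : nat -> {poly R[i]}) (f_Appell : pq_Appell p q f) :
  exists g : nat -> {poly R[i]},
    [/\ pq_Appell p q g,
        set_mul p f g =1 set_one p &
        set_mul p g f =1 set_one p].
Proof.
have [a a0 fE] := Appell_sequence q_gt0 q_lt_p f_Appell.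
pose c := reciprocal a.
have ca : cauchy_prod c a =1 (fun n => (n == 0)%:R) by apply: reciprocal_prod.
have c0 : c 0 != 0.
  (* In degree 0 the identity reads [c 0 * a 0 = 1]. *)
  have /eqP := ca 0; rewrite /cauchy_prod big_ord1 subnn /=.
  by apply: contraTneq => ->; rewrite mul0r eq_sym oner_eq0.
exists (Appell_of p q c); split; first exact: Appell_of_Appell.
- move=> n; rewrite -(Appell_of_one q_gt0 q_lt_p) -(eq_Appell_of _ _ ca).
  rewrite -(eq_Appell_of _ _ (cauchy_prodC a c)) -set_mul_Appell_of //.
  by apply: eq_bigr => k _; rewrite fE.
move=> n; rewrite -(Appell_of_one q_gt0 q_lt_p) -(eq_Appell_of _ _ ca).
by rewrite -set_mul_Appell_of //; apply: eq_bigr => k _; rewrite fE.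
Qed.
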